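(* Let $X$ be a Banach space over $\mathbb{K}$. (i) If $X$ is reflexive and locally uniformly rotund (LUR), then the pair $(X,\mathbb{K})$ has property $\mathbf{L}_{o,p}$. (ii) If $X$ has the Radon-Nikodým property and the pair $(X,\mathbb{K})$ has property $\mathbf{L}_{o,p}$, then $X$ is strictly convex.
   Context: Banach spaces are over $\mathbb{K}$, which is $\mathbb{R}$ or $\mathbb{C}$. $S_X$ denotes the unit sphere of $X$, and $\mathcal{L}(X,Y)$ the space of bounded linear operators from $X$ to $Y$ with the operator norm (so $\mathcal{L}(X,\mathbb{K})=X^*$). A pair $(X,Y)$ of Banach spaces has property $\mathbf{L}_{o,p}$ if for every $\varepsilon>0$ and every $x\in S_X$ there is $\eta(\varepsilon,x)>0$ such that whenever $T\in\mathcal{L}(X,Y)$ with $\|T\|=1$ satisfies $\|T(x)\|>1-\eta(\varepsilon,x)$, there is $x_0\in S_X$ with $\|T(x_0)\|=1$ and $\|x_0-x\|<\varepsilon$. $X$ is strictly convex if $\|\frac{x+y}{2}\|<1$ whenever $x,y\in S_X$, $x\neq y$. $X$ is locally uniformly rotund (LUR) if for all $x,x_n\in S_X$ ($n\in\mathbb{N}$), $\lim_n\|x_n+x\|=2$ implies $\lim_n\|x_n-x\|=0$. *)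

(* Defs.v *)
From HB Require Import structures.
From mathcomp Require Import all_boot all_order all_algebra.
From mathcomp Require Import complex.
From mathcomp Require Import all_classical all_reals all_analysis.

Set Implicit Arguments.
Unset Strict Implicit.
Unset Printing Implicit Defensive.

Import Order.TTheory GRing.Theory Num.Theory.
Import numFieldNormedType.Exports.

Local Open Scope classical_set_scope.
Local Open Scope ring_scope.

Variant scalar_kind := RealScalars | ComplexScalars.

Definition scalar_field (R : realType) (k : scalar_kind) : numFieldType :=
  match k with
  | RealScalars => R
  | ComplexScalars => R[i]
  end.

Definition of_real (R : realType) (k : scalar_kind) : R -> scalar_field R k :=
  match k with
  | RealScalars => fun r => r
  | ComplexScalars => fun r => r%:C%C
  end.

Definition to_real (R : realType) (k : scalar_kind) : scalar_field R k -> R :=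
  match k with
  | RealScalars => fun z => z
  | ComplexScalars => fun z => complex.Re z
  end.

(* The norm of a normed module over K takes its values in K, hence in R[i] for
   a complex space; rnorm is the same norm as an element of R. *)
Definition rnorm (R : realType) (k : scalar_kind)
    (X : normedModType (scalar_field R k)) (x : X) : R :=
  to_real `|x|.

(* For linear maps between normed modules, bounded means continuous. *)
Definition continuous_linear (K : numFieldType) (X Y : normedModType K) :
    {pred X -> Y} :=
  fun T => `[< linear T /\ continuous T >].

Record bounded_operator (K : numFieldType) (X Y : normedModType K) :=
  BoundedOperator {
    operator_fun :> X -> Y;
    operator_funP : operator_fun \in @continuous_linear K X Y }.

Section BoundedOperatorLmodule.
Variables (K : numFieldType) (X Y : normedModType K).

HB.instance Definition _ := [isSub for @operator_fun K X Y].
HB.instance Definition _ := [Choice of bounded_operator X Y by <:].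

Fact continuous_linear_submod_closed :
  submod_closed (@continuous_linear K X Y).
Proof.
split=> [|a f g].
  apply/asboolP; split=> [b x y|x]; last exact: cvg_cst.
  by rewrite -[LHS]/(0 : Y) -[RHS]/(b *: (0 : Y) + 0) scaler0 addr0.
move=> /asboolP[lf cf] /asboolP[lg cg]; apply/asboolP; split=> [b x y|x].
  rewrite -[LHS]/(a *: f (b *: x + y) + g (b *: x + y)).
  rewrite -[RHS]/(b *: (a *: f x + g x) + (a *: f y + g y)).
  by rewrite lf lg !scalerDr !scalerA [a * b]mulrC addrACA.
by apply: cvgD; [apply: cvgZ; [exact: cvg_cst|exact: cf]|exact: cg].
Qed.

HB.instance Definition _ := GRing.isSubmodClosed.Build K (X -> Y)
  (@continuous_linear K X Y) continuous_linear_submod_closed.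
HB.instance Definition _ :=
  [SubChoice_isSubLmodule of bounded_operator X Y by <:].

End BoundedOperatorLmodule.

Section Geometry.
Variables (R : realType) (k : scalar_kind).
Implicit Types X Y : normedModType (scalar_field R k).

Definition opnorm X Y (T : bounded_operator X Y) : R :=
  sup [set rnorm (T x) | x in [set x | rnorm x <= 1]].

Definition dual X := bounded_operator X (scalar_field R k)^o.

(* The canonical embedding of X into its bidual is onto. *)
Definition reflexive_space X :=
  forall phi : {linear dual X -> (scalar_field R k)^o},
    (exists M : R, forall f : dual X, rnorm (phi f) <= M * opnorm f) ->
    exists x : X, forall f : dual X, phi f = f x.

Definition strictly_convex X :=
  forall x y : X, rnorm x = 1 -> rnorm y = 1 -> x != y ->
    rnorm (2^-1 *: (x + y)) < 1.

Definition LUR X :=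
  forall (x : X) (x_ : nat -> X), rnorm x = 1 -> (forall n, rnorm (x_ n) = 1) ->
    rnorm (x_ n + x) @[n --> \oo] --> (2 : R) ->
    rnorm (x_ n - x) @[n --> \oo] --> (0 : R).

Definition property_Lop X Y :=
  forall (e : R) (x : X), 0 < e -> rnorm x = 1 ->
    exists2 eta : R, 0 < eta &
      forall T : bounded_operator X Y, opnorm T = 1 -> 1 - eta < rnorm (T x) ->
        exists x0 : X, [/\ rnorm x0 = 1, rnorm (T x0) = 1 & rnorm (x0 - x) < e].

End Geometry.

Section RadonNikodym.
Variables (R : realType) (k : scalar_kind).
Variable X : normedModType (scalar_field R k).
Variables (d : measure_display) (T : measurableType d).
Implicit Types (m : set T -> X) (mu : {finite_measure set T -> \bar R}).

Definition vector_measure m :=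
  forall F : nat -> set T, (forall i, measurable (F i)) -> trivIset setT F ->
    (\sum_(0 <= i < n) m (F i)) @[n --> \oo] --> m (\bigcup_i F i).

Definition bounded_variation_measure m :=
  exists M : R, forall (n : nat) (F : nat -> set T),
    (forall i, measurable (F i)) -> trivIset `I_n F ->
    \bigcup_(i < n) F i = setT ->
    \sum_(i < n) rnorm (m (F i)) <= M.

Definition abs_continuous_measure mu m :=
  forall A, measurable A -> mu A = 0%E -> m A = 0.

Definition simple_fun (s : T -> X) :=
  finite_set (range s) /\ forall x, measurable (s @^-1` [set x]).

Definition simple_integral mu (E : set T) (s : T -> X) : X :=
  \sum_(x \in range s) of_real k (fine (mu (E `&` s @^-1` [set x]))) *: x.

(* f is Bochner integrable (on the whole of T) and v is its integral over E;
   v does not depend on the approximating sequence s. *)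
Definition is_Bochner_integral mu (E : set T) (f : T -> X) (v : X) :=
  exists s : nat -> T -> X,
    [/\ forall n, simple_fun (s n),
        {ae mu, forall t, s n t @[n --> \oo] --> f t},
        (\int[mu]_t (rnorm (f t - s n t))%:E)%E @[n --> \oo] --> 0%E &
        simple_integral mu E (s n) @[n --> \oo] --> v].

End RadonNikodym.

Definition Radon_Nikodym_property (R : realType) (k : scalar_kind)
    (X : normedModType (scalar_field R k)) :=
  forall (d : measure_display) (T : measurableType d)
      (mu : {finite_measure set T -> \bar R}) (m : set T -> X),
    vector_measure m -> bounded_variation_measure m ->
    abs_continuous_measure mu m ->
    exists f : T -> X,
      forall E, measurable E -> is_Bochner_integral mu E f (m E).

(* Main.v *)
(* (i) By Hahn-Banach on the dual, a norm-one functional f on a reflexive space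
   attains its norm at some y, and rotating y by a phase gives
   |y + x| >= 1 + |f x|; along a sequence of functionals with |f_n x| -> 1, local
   uniform rotundity forces y_n -> x.
   (ii) If x <> y are unit vectors with a midpoint of norm one, take norm-one
   functionals f, g with f x = f y = 1 and g (x - y) = |x - y|.  For small t > 0
   the functional f + t g is almost normed by y, so the L_{o,p} property gives
   y0 near y norming it, whence 1 + t Re (g x) <= |f + t g| <= 1 + t Re (g y0) up
   to a phase close to 1.  Thus Re (g x) <= Re (g y) + small, a contradiction.
   Hahn-Banach is proved without extending functionals from subspaces: a minimal
   sublinear functional is additive, and Zorn provides a minimal one below any
   sublinear functional. *)

Require Import Defs.
From HB Require Import structures.
From mathcomp Require Import all_boot all_order all_algebra.
From mathcomp Require Import complex.
From mathcomp Require Import all_classical all_reals all_analysis.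
From mathcomp Require Import ring lra.

Set Implicit Arguments.
Unset Strict Implicit.
Unset Printing Implicit Defensive.

Import Order.TTheory GRing.Theory Num.Theory.
Import numFieldNormedType.Exports.

Local Open Scope classical_set_scope.
Local Open Scope ring_scope.

(** * Hahn-Banach domination on real vector spaces *)

Section RealHahnBanach.
Variables (R : realType) (V : lmodType R).
Implicit Types (p q : V -> R) (x y : V).

(** Homogeneity is an inequality, a form easily checked for infima; equality follows by rescaling
    with the inverse factor. *)
Definition sublinear p :=
  (forall x y, p (x + y) <= p x + p y) /\
  (forall r x, 0 <= r -> p (r *: x) <= r * p x).

Lemma sublinear0 p : sublinear p -> p 0 = 0.
Proof.
case=> pD pZ; have := pZ 0 0 (lexx 0); have := pD 0 0.
by rewrite addr0 scale0r mul0r => *; lra.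
Qed.

Lemma sublinearZ p r x : sublinear p -> 0 <= r -> p (r *: x) = r * p x.
Proof.
move=> sp; rewrite le_eqVlt => /predU1P[<-|r0].
  by rewrite scale0r mul0r sublinear0.
apply/eqP; rewrite eq_le sp.2 ?(ltW r0)//= -ler_pdivlMl//.
by rewrite -{1}[x](scalerK (lt0r_neq0 r0)) sp.2// invr_ge0 ltW.
Qed.

Lemma sublinear_opp p x : sublinear p -> - p (- x) <= p x.
Proof.
move=> sp; have := sp.1 x (- x).
by rewrite subrr sublinear0// => ?; lra.
Qed.

(* A scalar function below [descent p y] is below p and agrees with p at y. *)
Definition descent p y x : R :=
  inf [set p (x + t *: y) - t * p y | t in [set t | 0 <= t]].

Lemma le_descent p y x a :
  (forall t, 0 <= t -> a <= p (x + t *: y) - t * p y) -> a <= descent p y x.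
Proof.
move=> pa; apply: lb_le_inf; last by move=> _ [t t0 <-]; exact: pa.
by exists (p (x + 0 *: y) - 0 * p y), 0 => /=.
Qed.

Lemma descent_le p y x t : sublinear p -> 0 <= t ->
  descent p y x <= p (x + t *: y) - t * p y.
Proof.
move=> sp t0; apply: ge_inf; last by exists t.
(* Subadditivity on [s *: y = (x + s *: y) - x] bounds the set below by [- p (- x)]. *)
exists (- p (- x)) => _ [s s0 <-].
have := sp.1 (x + s *: y) (- x); rewrite addrAC subrr add0r sublinearZ// => ?.
by lra.
Qed.

(** Parameters [s] and [t] for the two summands combine into [s + t]; under scaling by [r > 0], [t]
    becomes [r * t]. *)
Lemma descent_sublinear p y : sublinear p -> sublinear (descent p y).
Proof.
move=> sp; split=> [x1 x2|r x].
  rewrite -lerBlDr; apply: le_descent => s s0.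
  rewrite lerBlDr -lerBlDl; apply: le_descent => t t0.
  rewrite lerBlDl (le_trans (descent_le y _ sp (addr_ge0 s0 t0)))//.
  rewrite scalerDl addrACA; have := sp.1 (x1 + s *: y) (x2 + t *: y).
  by move=> ?; lra.
rewrite le_eqVlt => /predU1P[<-|r0].
  rewrite scale0r mul0r (le_trans (descent_le y 0 sp (lexx 0)))//.
  by rewrite scale0r addr0 mul0r subr0 sublinear0.
rewrite -ler_pdivrMl//; apply: le_descent => t t0; rewrite ler_pdivrMl//.
rewrite (le_trans (descent_le y _ sp (mulr_ge0 (ltW r0) t0)))//.
by rewrite -scalerA -scalerDr (sublinearZ _ sp (ltW r0)) mulrBr mulrA.
Qed.

(** Zorn's lemma applies because the pointwise infimum of a nonempty chain is again sublinear and
    below [p]. *)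
Lemma minimal_sublinear p : sublinear p ->
  exists q, [/\ sublinear q, forall x, q x <= p x &
    forall q', sublinear q' -> (forall x, q' x <= q x) -> q' = q].
Proof.
move=> sp; pose T := {q | sublinear q /\ forall x, q x <= p x}.
(* The order is reversed: its maximal elements are the minimal functionals. *)
pose below (s t : T) := `[< forall x, sval t x <= sval s x >].
have [||||[q [sq qp]] qmin] := @Zorn T below.
- by move=> t; apply/asboolP.
- move=> r s t /asboolP rs /asboolP st; apply/asboolP => x.
  exact: le_trans (st x) (rs x).
- move=> [s Ps] [t Pt] /asboolP st /asboolP ts; apply: eq_exist.
  by apply/funext => x; apply/eqP; rewrite eq_le st ts.
- move=> A totA; have [[s0 As0]|A0] := pselect (A !=set0); last first.
    exists (exist _ p (conj sp (fun x => lexx (p x)))) => s As.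
    by exfalso; apply: A0; exists s.
  pose g x := inf [set sval s x | s in A].
  have le_g a x : (forall s, A s -> a <= sval s x) -> a <= g x.
    move=> Aa; apply: lb_le_inf; last by move=> _ [s As <-]; exact: Aa.
    by exists (sval s0 x), s0.
  have g_le s x : A s -> g x <= sval s x.
    move=> As; apply: ge_inf; last by exists s.
    exists (- p (- x)) => _ [[t [st tp]] _ <-] /=.
    by rewrite (le_trans _ (sublinear_opp x st))// lerN2.
  have sg : sublinear g.
    split=> [x y|r x].
      rewrite -lerBlDr; apply: (le_g) => s As; rewrite lerBlDr -lerBlDl.
      apply: (le_g) => t At; rewrite lerBlDl.
      (* Of two comparable members, the smaller one is used at both [x] and [y]. *)
      have [/asboolP st|/asboolP ts] := totA _ _ As At.
        rewrite (le_trans (g_le t _ At))// (le_trans ((svalP t).1.1 x y))//.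
        by rewrite lerD2r.
      rewrite (le_trans (g_le s _ As))// (le_trans ((svalP s).1.1 x y))//.
      by rewrite lerD2l.
    rewrite le_eqVlt => /predU1P[<-|r0].
      rewrite mul0r scale0r (le_trans (g_le s0 _ As0))//.
      by rewrite sublinear0//; case: (svalP s0).
    rewrite -ler_pdivrMl//; apply: (le_g) => s As; rewrite ler_pdivrMl//.
    rewrite (le_trans (g_le s _ As))// (sublinearZ _ _ (ltW r0))//.
    by case: (svalP s).
  have gp x : g x <= p x.
    by rewrite (le_trans (g_le s0 x As0))//; case: (svalP s0).
  by exists (exist _ g (conj sg gp)) => s As; apply/asboolP => x; exact: g_le.
exists q; split=> // q' sq' q'q.
have q'p x : q' x <= p x by exact: le_trans (q'q x) (qp x).
by have /(congr1 sval) := qmin (exist _ q' (conj sq' q'p)) (asboolT q'q).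
Qed.

(* A minimal sublinear functional equals its own descents, hence is additive. *)
Lemma sublinear_dominates_scalar p : sublinear p ->
  exists2 u : V -> R, scalar u & forall x, u x <= p x.
Proof.
move=> /minimal_sublinear[q [sq qp qmin]]; exists q => //.
have descent_q y : descent q y = q.
  apply: qmin => [|x]; first exact: descent_sublinear.
  rewrite (le_trans (descent_le y x sq (lexx 0)))//.
  by rewrite scale0r addr0 mul0r subr0.
(* The parameter [t = 1] in the descent gives [q x <= q (x + y) - q y], the converse of
   subadditivity. *)
have qD x y : q (x + y) = q x + q y.
  apply/eqP; rewrite eq_le sq.1/= -lerBrDr -{1}(descent_q y).
  by have := descent_le y x sq ler01; rewrite scale1r mul1r.
have qN x : q (- x) = - q x.
  by apply/eqP; rewrite -addr_eq0 -qD addNr sublinear0.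
move=> a x y; rewrite qD; congr (_ + _).
have [a0|/ltW a0] := leP 0 a; first exact: sublinearZ.
by rewrite -[a]opprK scaleNr qN mulNr sublinearZ// oppr_ge0.
Qed.

Lemma hahn_banach p v : sublinear p ->
  exists u : V -> R, [/\ scalar u, forall x, u x <= p x & u v = p v].
Proof.
move=> sp.
have [u lu up] := sublinear_dominates_scalar (descent_sublinear v sp).
have {}up x t : 0 <= t -> u x <= p (x + t *: v) - t * p v.
  by move=> t0; exact: le_trans (up x) (descent_le v x sp t0).
have u0 : u 0 = 0.
  by have := lu (-1) 0 0; rewrite scaler0 addr0 mulN1r addNr.
have u_le x : u x <= p x.
  by have := up x 0 (lexx 0); rewrite scale0r addr0 mul0r subr0.
exists u; split=> //; apply/eqP; rewrite eq_le u_le/=.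
(* At [- v] with [t = 1] the bound reads [u (- v) <= - p v], that is [p v <= u v]. *)
have := up (- v) 1 ler01; rewrite scale1r addNr sublinear0// mul1r sub0r.
have := lu (-1) v 0; rewrite !addr0 scaleN1r u0 addr0 mulN1r => ->.
by rewrite lerN2.
Qed.

End RealHahnBanach.

(** * Real and complex scalars treated uniformly *)

Lemma Re_eq_norm (R : realType) (z : R[i]) :
  complex.Re z = complex.Re `|z| -> z = `|z|.
Proof.
move=> zE; have zR : (complex.Re z)%:C%C = `|z|.
  by rewrite zE RRe_real ?normr_real.
(* The squares of the real and imaginary parts add up to that of the modulus, so the imaginary part
   vanishes. *)
have /eqP := add_Re2_Im2 z.
rewrite -zR -rmorphXn/= (inj_eq (@complexI R)) -[eqbRHS]addr0.
rewrite (inj_eq (addrI _)) sqrf_eq0 => /eqP Imz.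
by rewrite [LHS]complexE Imz mulr0 addr0.
Qed.

Section Scalars.
Variables (R : realType) (k : scalar_kind).
Local Notation K := (scalar_field R k).
Local Notation of_real := (@of_real R k).
Local Notation to_real := (@to_real R k).
Implicit Types (a b : R) (z w : K).

Lemma of_realK : cancel of_real to_real.
Proof. by case: k. Qed.

Lemma to_realK z : 0 <= z -> of_real (to_real z) = z.
Proof. by case: k z => //= z z0; rewrite RRe_real// ger0_real. Qed.

Lemma of_realD a b : of_real (a + b) = of_real a + of_real b.
Proof. by case: k => //=; rewrite raddfD. Qed.

Lemma of_realN a : of_real (- a) = - of_real a.
Proof. by case: k => //=; rewrite raddfN. Qed.

Lemma of_realM a b : of_real (a * b) = of_real a * of_real b.
Proof. by case: k => //=; rewrite rmorphM. Qed.

Lemma of_real1 : of_real 1 = 1.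
Proof. by case: k. Qed.

Lemma of_real0 : of_real 0 = 0.
Proof. by case: k. Qed.

Lemma of_realV a : of_real a^-1 = (of_real a)^-1.
Proof. by case: k => //=; rewrite fmorphV. Qed.

Lemma ler_of_real a b : (of_real a <= of_real b) = (a <= b).
Proof. by case: k => //=; rewrite lecR. Qed.

Lemma ltr_of_real a b : (of_real a < of_real b) = (a < b).
Proof. by case: k => //=; rewrite ltcR. Qed.

Lemma norm_of_real a : to_real `|of_real a| = `|a|.
Proof.
have [a0|a0] := leP 0 a.
  have oa0 : 0 <= of_real a by rewrite -[leLHS]of_real0 ler_of_real.
  by rewrite !ger0_norm// of_realK.
have oa0 : of_real a < 0 by rewrite -[ltRHS]of_real0 ltr_of_real.
by rewrite !ltr0_norm// -of_realN of_realK.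
Qed.

Lemma to_realD z w : to_real (z + w) = to_real z + to_real w.
Proof. by case: k z w => //= -[? ?] [? ?]. Qed.

Lemma to_realZ a z : to_real (of_real a * z) = a * to_real z.
Proof. by case: k z => //= -[x y] /=; rewrite mul0r subr0. Qed.

Lemma to_real_ge0 z : 0 <= z -> 0 <= to_real z.
Proof. by move=> z0; rewrite -ler_of_real to_realK// of_real0. Qed.

Lemma to_real_norm z : to_real z <= to_real `|z|.
Proof.
case: k z => /= z; first exact: ler_norm.
rewrite -lecR (RRe_real (normr_real z)); apply: le_trans (normc_ge_Re z).
by rewrite lecR ler_norm.
Qed.

End Scalars.

(** * The real-valued norm, on modules and then on the scalars *)

Section RealNorm.
Variables (R : realType) (k : scalar_kind).
Local Notation K := (scalar_field R k).
Variable X : normedModType K.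
Implicit Types (x y : X) (a : R) (z w : K).

Lemma rnormE x : `|x| = of_real k (rnorm x).
Proof. by rewrite /rnorm to_realK. Qed.

Lemma rnorm_ge0 x : 0 <= rnorm x.
Proof. exact: to_real_ge0. Qed.

Lemma rnorm0 : rnorm (0 : X) = 0.
Proof. by rewrite /rnorm normr0 -of_real0 of_realK. Qed.

Lemma rnorm_eq0 x : (rnorm x == 0) = (x == 0).
Proof.
rewrite -[x == 0]normr_eq0 rnormE -of_real0.
by rewrite (can_eq (@of_realK R k)).
Qed.

Lemma rnormD x y : rnorm (x + y) <= rnorm x + rnorm y.
Proof. by rewrite -(ler_of_real k) of_realD -!rnormE ler_normD. Qed.

Lemma rnormN x : rnorm (- x) = rnorm x.
Proof. by rewrite /rnorm normrN. Qed.

Lemma rnormB x y : rnorm (x - y) = rnorm (y - x).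
Proof. by rewrite -rnormN opprB. Qed.

End RealNorm.

Section ScalarNorm.
Variables (R : realType) (k : scalar_kind).
Local Notation K := (scalar_field R k).
Implicit Types (a : R) (z w : K^o).

Lemma rnormZ (X : normedModType K) (z : K) (x : X) :
  rnorm (z *: x) = rnorm (z : K^o) * rnorm x.
Proof.
rewrite -[LHS]/(to_real `|z *: x|) normrZ (rnormE x) -[`|z|]/(`|z : K^o|).
by rewrite (rnormE (z : K^o)) -of_realM of_realK.
Qed.

Lemma rnormM z w : rnorm (z * w : K^o) = rnorm z * rnorm w.
Proof. exact: rnormZ. Qed.

Lemma rnorm_of_real a : rnorm (of_real k a : K^o) = `|a|.
Proof.
exact: norm_of_real.
Qed.

Lemma rnorm1 : rnorm (1 : K^o) = 1.
Proof. by rewrite -of_real1 rnorm_of_real normr1. Qed.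

Lemma rnormV z : rnorm (z^-1 : K^o) = (rnorm z)^-1.
Proof.
have [->|z0] := eqVneq z 0; first by rewrite invr0 rnorm0 invr0.
apply: (mulIf (_ : rnorm z != 0)); first by rewrite rnorm_eq0.
by rewrite -rnormM !mulVf ?rnorm1 ?rnorm_eq0.
Qed.

Lemma to_real_le_rnorm z : to_real z <= rnorm z.
Proof. exact: to_real_norm. Qed.

(** The chain [a <= to_real z <= rnorm z <= a] collapses, and a scalar whose real part equals its
    modulus is that modulus. *)
Lemma to_real_eq_rnorm z a : rnorm z <= a -> a <= to_real z -> z = of_real k a.
Proof.
move=> za az.
have zz := to_real_le_rnorm z.
have -> : a = rnorm z by apply/eqP; rewrite eq_le (le_trans az).
have {za zz}az : to_real z = rnorm z.
  by apply/eqP; rewrite eq_le zz (le_trans za).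
rewrite -rnormE; case: k z az => //= z; exact: Re_eq_norm.
Qed.

Lemma exists_phase z :
  exists2 c : K^o, rnorm c = 1 & c * z = of_real k (rnorm z).
Proof.
have [->|z0] := eqVneq z 0.
  by exists 1; rewrite ?rnorm1// mulr0 rnorm0 of_real0.
exists (`|z| / z); last by rewrite divfK// rnormE.
by rewrite /rnorm normrM normfV normr_id divff ?normr_eq0// -of_real1 of_realK.
Qed.

End ScalarNorm.

(** * Restriction of scalars to the reals, on an alias so that both module structures coexist *)

Definition real_restriction (R : realType) (k : scalar_kind)
  (V : lmodType (scalar_field R k)) : Type := V.

Section RealRestriction.
Variables (R : realType) (k : scalar_kind) (V : lmodType (scalar_field R k)).

HB.instance Definition _ := GRing.Zmodule.on (real_restriction V).

Let real_scale (a : R) (x : real_restriction V) : real_restriction V :=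
  of_real k a *: (x : V).

Let real_scaleA a b x : real_scale a (real_scale b x) = real_scale (a * b) x.
Proof. by rewrite /real_scale scalerA of_realM. Qed.

Let real_scale1 : left_id 1 real_scale.
Proof. by move=> x; rewrite /real_scale of_real1 scale1r. Qed.

Let real_scaleDr : right_distributive real_scale +%R.
Proof. by move=> a x y; exact: scalerDr. Qed.

Let real_scaleDl x : {morph real_scale^~ x : a b / a + b}.
Proof. by move=> a b; rewrite /real_scale of_realD scalerDl. Qed.

HB.instance Definition _ := GRing.Zmodule_isLmodule.Build R (real_restriction V)
  real_scaleA real_scale1 real_scaleDr real_scaleDl.

End RealRestriction.

(* In the complex case f x = u x - i u (i x). *)
Lemma scalar_of_real_part (R : realType) (k : scalar_kind)
    (V : lmodType (scalar_field R k)) (u : real_restriction V -> R) :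
  scalar u ->
  exists2 f : V -> (scalar_field R k)^o, linear f &
    forall x, to_real (f x) = u x.
Proof.
case: k V u => /= V u lu; first by exists u.
have uD x y : u (x + y) = u x + u y by have := lu 1 x y; rewrite scale1r mul1r.
have u0 : u 0 = 0 by apply: (addrI (u 0)); rewrite -uD !addr0.
have uZ (a : R) (x : V) : u (a%:C%C *: x) = a * u x.
  by have := lu a x 0; rewrite !addr0 u0 addr0.
exists (fun x : V => (u x -i* u ('i%C *: x))%C) => // -[a b] x y.
(* Real homogeneity of [u] handles [a] and [b]; compatibility with [i] is built into the formula. *)
have -> : (a +i* b)%C = a%:C%C + b%:C%C * 'i%C.
  by rewrite [LHS]complexE mulrC.
have ii : 'i%C * 'i%C = -1 :> R[i] by rewrite -expr2 sqr_i.
have uN z : u (- z) = - u z by apply: (addrI (u z)); rewrite -uD !subrr u0.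
rewrite scalerDr scalerA mulrDr mulrA [_ * a%:C%C]mulrC.
rewrite -!mulrA ['i%C * _]mulrCA ii.
rewrite !scalerDl -!scalerA scaleN1r !(uD, uZ) uN.
by apply/eqP; rewrite eq_complex /=; apply/andP; split; apply/eqP; ring.
Qed.

(** * Hahn-Banach for seminorms over either field *)

Section HahnBanach.
Variables (R : realType) (k : scalar_kind).
Local Notation K := (scalar_field R k).
Variable V : lmodType K.
Implicit Types (p : V -> R) (x y v : V).

Definition seminorm p :=
  (forall x y, p (x + y) <= p x + p y) /\
  (forall (c : K^o) x, p (c *: x) = rnorm c * p x).

(** The real theorem bounds the real part of [f]; rotating [x] until [f x] is nonnegative turns this
    into a bound on the modulus. At [v] the real part already reaches that bound, which forces the
    value. *)
Theorem hahn_banach_seminorm p v : seminorm p ->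
  exists f : V -> K^o,
    [/\ linear f, forall x, rnorm (f x) <= p x & f v = of_real k (p v)].
Proof.
move=> [pD pZ].
have sp : sublinear (p : real_restriction V -> R).
  by split=> // r x r0; rewrite [leLHS]pZ rnorm_of_real ger0_norm.
have [u [lu up uv]] := @hahn_banach R (real_restriction V) p v sp.
have [f lf fu] := scalar_of_real_part lu.
have fp x : rnorm (f x) <= p x.
  have [c c1 cfx] := exists_phase (f x).
  have f0 : f 0 = 0.
    by have := lf (-1) 0 0; rewrite scaler0 addr0 scaleN1r addNr.
  have : f (c *: x) = of_real k (rnorm (f x)).
    by rewrite -cfx; have := lf c x 0; rewrite !addr0 f0 addr0.
  move/(congr1 (@to_real R k)); rewrite fu of_realK => <-.
  by rewrite (le_trans (up _))// pZ c1 mul1r.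
exists f; split=> //; apply: to_real_eq_rnorm => //.
by rewrite fu uv.
Qed.

End HahnBanach.

(** * Bounded operators and the operator norm *)

Section BoundedOperators.
Variables (R : realType) (k : scalar_kind).
Local Notation K := (scalar_field R k).
Variables X Y : normedModType K.
Implicit Types T : bounded_operator X Y.

Lemma operator_linear T : linear T.
Proof. by have /asboolP[] := operator_funP T. Qed.

Lemma operatorD T x y : T (x + y) = T x + T y.
Proof. by have := operator_linear T 1 x y; rewrite !scale1r. Qed.

Lemma operator0 T : T 0 = 0.
Proof. by apply: (addrI (T 0)); rewrite -operatorD !addr0. Qed.

Lemma operatorZ T a x : T (a *: x) = a *: T x.
Proof. by have := operator_linear T a x 0; rewrite !addr0 operator0 addr0. Qed.

Lemma operatorB T x y : T (x - y) = T x - T y.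
Proof. by rewrite operatorD -scaleN1r operatorZ scaleN1r. Qed.

Lemma operator_bounded T :
  exists2 M : R, 0 <= M & forall x, rnorm (T x) <= M * rnorm x.
Proof.
have /asboolP[lT cT] := operator_funP T.
pose L : {linear X -> Y} :=
  HB.pack (T : X -> Y) (GRing.isLinear.Build K X Y _ T lT).
have /linear_bounded_continuous/linear_boundedP/pinfty_ex_gt0[M M0 TM] :
  continuous L by exact: cT.
exists (to_real M) => [|x]; first exact/to_real_ge0/ltW.
rewrite -(ler_of_real k) of_realM (to_realK (ltW M0)) -!rnormE.
exact: TM.
Qed.

Lemma bounded_operator_of (f : X -> Y) (M : R) : linear f ->
  (forall x, rnorm (f x) <= M * rnorm x) ->
  exists T, forall x, T x = f x.
Proof.
move=> lf fM.
pose L : {linear X -> Y} :=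
  HB.pack f (GRing.isLinear.Build K X Y _ f lf).
have cf : f \in @continuous_linear K X Y.
  apply/asboolP; split => //; apply: (@bounded_linear_continuous _ _ _ L).
  apply/ex_bound; exists (of_real k `|M|); apply/nbhs_norm0P.
  exists 1 => //= x /=.
  move=> /ltW; rewrite !rnormE -of_real1 !ler_of_real => x1.
  rewrite (le_trans (fM x))//.
  rewrite (le_trans (ler_wpM2r (rnorm_ge0 x) (ler_norm M)))//.
  by rewrite ler_piMr.
by exists (BoundedOperator cf).
Qed.

Lemma rnorm_operator_le T x : rnorm (T x) <= opnorm T * rnorm x.
Proof.
have [M M0 TM] := operator_bounded T.
(* Boundedness of [T] makes [opnorm T] a true supremum rather than the default value of [sup]. *)
have ball_le y : rnorm y <= 1 -> rnorm (T y) <= opnorm T.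
  move=> y1; apply: sup_upper_bound; last by exists y.
  split; first by exists (rnorm (T y)), y.
  by exists M => _ [z /= z1 <-]; rewrite (le_trans (TM z))// ler_piMr.
have [->|x0] := eqVneq x 0; first by rewrite operator0 !rnorm0 mulr0.
have nx0 : 0 < rnorm x by rewrite lt_def rnorm_eq0 x0 rnorm_ge0.
rewrite -ler_pdivrMr// mulrC.
have nV : rnorm (of_real k (rnorm x)^-1 : K^o) = (rnorm x)^-1.
  by rewrite rnorm_of_real ger0_norm// invr_ge0 ltW.
rewrite -nV -rnormZ -operatorZ; apply: ball_le.
by rewrite rnormZ nV mulVf// gt_eqF.
Qed.

Lemma opnorm_le T M : 0 <= M -> (forall x, rnorm (T x) <= M * rnorm x) ->
  opnorm T <= M.
Proof.
move=> M0 TM; apply: ge_sup => [|_ [x /= x1 <-]].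
  by exists (rnorm (T 0)), 0 => //=; rewrite rnorm0.
by rewrite (le_trans (TM x))// ler_piMr.
Qed.

Lemma opnorm_ge0 T : 0 <= opnorm T.
Proof.
have [M M0 TM] := operator_bounded T.
apply: (le_trans (rnorm_ge0 (T 0))); apply: sup_upper_bound; last first.
  by exists 0 => //=; rewrite rnorm0.
split; first by exists (rnorm (T 0)), 0 => //=; rewrite rnorm0.
by exists M => _ [z /= z1 <-]; rewrite (le_trans (TM z))// ler_piMr.
Qed.

(** This opens the dual space to Hahn-Banach. One inequality for all scalars suffices for
    homogeneity: the reverse one is its instance at [c^-1] and [c *: T]. *)
Lemma opnorm_seminorm : seminorm (@opnorm R k X Y).
Proof.
split=> [S T|c T].
  apply: opnorm_le => [|x]; first by rewrite addr_ge0 ?opnorm_ge0.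
  rewrite mulrDl (le_trans (rnormD (S x) (T x)))//.
  by rewrite lerD ?rnorm_operator_le.
have leZ (a : K^o) (S : bounded_operator X Y) :
    opnorm (a *: S) <= rnorm a * opnorm S.
  apply: opnorm_le => [|x]; first by rewrite mulr_ge0 ?rnorm_ge0 ?opnorm_ge0.
  rewrite -[(a *: S) x]/(a *: S x) rnormZ -mulrA ler_wpM2l ?rnorm_ge0//.
  exact: rnorm_operator_le.
apply/eqP; rewrite eq_le leZ/=.
have [->|c0] := eqVneq c 0; first by rewrite rnorm0 mul0r opnorm_ge0.
have nc0 : 0 < rnorm c by rewrite lt_def rnorm_eq0 c0 rnorm_ge0.
rewrite -ler_pdivlMl// -rnormV.
by have := leZ c^-1 (c *: T); rewrite scalerA mulVf// scale1r.
Qed.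

End BoundedOperators.

(** * Norming functionals and norm attainment under reflexivity *)

Section Duality.
Variables (R : realType) (k : scalar_kind).
Local Notation K := (scalar_field R k).
Variable X : normedModType K.
Implicit Types (x y : X) (f g : dual X).

Lemma rnorm_seminorm : seminorm (@rnorm R k X).
Proof. by split=> [x y|c x]; [exact: rnormD|exact: rnormZ]. Qed.

Lemma norming_functional x :
  exists2 f : dual X,
    forall y, rnorm (f y) <= rnorm y & f x = of_real k (rnorm x).
Proof.
have [f [lf f1 fx]] := hahn_banach_seminorm x rnorm_seminorm.
have [|T Tf] := @bounded_operator_of _ _ _ _ f 1 lf.
  by move=> y; rewrite mul1r.
by exists T => [y|]; rewrite Tf.
Qed.

(** Hahn-Banach on the dual gives a functional [phi] bounded by [opnorm] with [phi f = 1];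
    reflexivity represents it by a point. *)
Lemma reflexive_norm_attaining f : reflexive_space X -> opnorm f = 1 ->
  exists2 x, rnorm x = 1 & f x = 1.
Proof.
move=> reflX f1.
have [phi [lphi phi_le phif]] :=
  hahn_banach_seminorm f (@opnorm_seminorm R k X K^o).
pose L : {linear dual X -> K^o} :=
  HB.pack phi (GRing.isLinear.Build K (dual X) K^o _ phi lphi).
have [|x Lx] := reflX L; first by exists 1 => g; rewrite mul1r; exact: phi_le.
have {}Lx (g : dual X) : phi g = g x by exact: Lx.
have fx : f x = 1 by rewrite -Lx phif f1 of_real1.
(* The upper bound tests [phi] on a functional norming [x]; the lower bound comes from [f x = 1]. *)
exists x => //; apply/eqP; rewrite eq_le; apply/andP; split.
  have [g g1 gx] := norming_functional x.
  have := phi_le g; rewrite Lx gx rnorm_of_real ger0_norm ?rnorm_ge0//.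
  move=> /le_trans; apply; apply: opnorm_le => // y.
  by rewrite mul1r.
by have := rnorm_operator_le f x; rewrite fx f1 mul1r rnorm1.
Qed.

(** With [f y = 1] and [c] the phase making [c * f x] nonnegative, [f] takes the value
    [1 + rnorm (f x)] at [y + c *: x]; multiplying by [c^-1] preserves norms. *)
Lemma norm_attaining_aligned f x : reflexive_space X -> opnorm f = 1 ->
  exists y,
    [/\ rnorm y = 1, rnorm (f y) = 1 & 1 + rnorm (f x) <= rnorm (y + x)].
Proof.
move=> reflX f1; have [y y1 fy] := reflexive_norm_attaining reflX f1.
have [c c1 cfx] := exists_phase (f x).
have c0 : c != 0 by rewrite -rnorm_eq0 c1 oner_eq0.
have cV1 : rnorm (c^-1 : K^o) = 1.
  by rewrite rnormV c1 invr1.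
exists (c^-1 *: y); split.
- by rewrite rnormZ cV1 mul1r.
- by rewrite operatorZ rnormZ cV1 mul1r fy rnorm1.
have -> : c^-1 *: y + x = c^-1 *: (y + c *: x).
  by rewrite scalerDr scalerA mulVf// scale1r.
rewrite rnormZ cV1 mul1r; have := rnorm_operator_le f (y + c *: x).
rewrite f1 mul1r; apply: le_trans.
rewrite operatorD operatorZ -[c *: f x]/(c * f x) cfx fy -of_real1 -of_realD.
by rewrite rnorm_of_real ler_norm.
Qed.

End Duality.

(** * The two implications *)

Section Proposition.
Variables (R : realType) (k : scalar_kind).
Local Notation K := (scalar_field R k).
Variable X : normedModType K.

Lemma reflexive_LUR_property_Lop :
  reflexive_space X -> LUR X -> property_Lop X K^o.
Proof.
move=> reflX lurX e x e0 x1; apply: contrapT => noeta.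
have /choice[y y_] (n : nat) : exists y : X,
    [/\ rnorm y = 1, 2 - n.+1%:R^-1 <= rnorm (y + x) & e <= rnorm (y - x)].
  (* Without such a [y], [1 / (n + 1)] would serve as [eta]: the aligned point of any admissible [T]
     would lie within [e] of [x]. *)
  apply: contrapT => noy; apply: noeta; exists n.+1%:R^-1 => [|T T1 Tx].
    by rewrite invr_gt0.
  have [y [y1 Ty yx]] := norm_attaining_aligned x reflX T1.
  exists y; split=> //; rewrite ltNge; apply/negP => ye.
  apply: noy; exists y; split=> //; apply: le_trans yx.
  by rewrite -[2]/(1 + 1) -addrA lerD2l; exact: ltW.
have /cvgrPdist_lt/(_ _ e0)[N _ /(_ N (leqnn N))/=] :
    rnorm (y n - x) @[n --> \oo] --> (0 : R).
  apply: lurX => // [n|]; first by have [] := y_ n.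
  apply: (@squeeze_cvgr _ _ _ _ (fun n => 2 - n.+1%:R^-1) (cst 2)).
  - near=> n; have [yn1 yn2 _] := y_ n; rewrite yn2/=.
    by rewrite (le_trans (rnormD _ _))// yn1 x1.
  - rewrite -[X in _ --> X]subr0; apply: cvgB; first exact: cvg_cst.
    exact: cvg_harmonic.
  - exact: cvg_cst.
rewrite sub0r normrN ger0_norm ?rnorm_ge0// ltNge.
by have [_ _ ->] := y_ N.
Unshelve. all: by end_near. Qed.

Lemma property_Lop_strictly_convex : property_Lop X K^o -> strictly_convex X.
Proof.
move=> Lop x y x1 y1 xy; rewrite ltNge; apply/negP => mid.
have [f f_le fmid] := norming_functional (2^-1 *: (x + y)).
(* Both real parts are at most 1, while the midpoint forces their sum to be at least 2. *)
have [fx fy] : f x = 1 /\ f y = 1.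
  have fx1 := to_real_le_rnorm (f x); have fy1 := to_real_le_rnorm (f y).
  have := f_le x; have := f_le y; rewrite x1 y1 => fy_le fx_le.
  have : 2 <= to_real (f x) + to_real (f y).
    have half : (2^-1 : K) = of_real k 2^-1.
      by rewrite of_realV; congr (_^-1); rewrite of_realD of_real1.
    have := congr1 (@to_real R k) fmid.
    rewrite of_realK operatorZ operatorD half.
    by rewrite to_realZ to_realD -half => fmidE; lra.
  move=> fxy; rewrite -of_real1.
  by split; apply: to_real_eq_rnorm => //; lra.
have [g g_le gxy] := norming_functional (x - y).
have D0 : 0 < rnorm (x - y) by rewrite lt_def rnorm_eq0 subr_eq0 xy rnorm_ge0.
have gD : to_real (g x) = to_real (g y) + rnorm (x - y).
  rewrite -[X in _ + X](of_realK k) -gxy -to_realD operatorB.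
  by rewrite addrCA subrr addr0.
set D := rnorm (x - y) in D0 gD.
have e0 : 0 < D / 8 by rewrite divr_gt0.
have [eta eta0 etaP] := Lop _ _ e0 y1.
(* The bound [D / 8] keeps the final error within [D / 2]; [2^-1] gives [N >= 2^-1] below; [eta / 8]
   then gives [(1 - eta) * N < 1 - t]. *)
pose t := Num.min (D / 8) (Num.min 2^-1 (eta / 8)).
have t0 : 0 < t by rewrite !lt_min e0 invr_gt0 divr_gt0 ?ltr0n.
have tD : t <= D / 8 by rewrite ge_min lexx.
have t2 : t <= 2^-1 by rewrite !ge_min lexx orbT.
have teta : t <= eta / 8 by rewrite !ge_min lexx !orbT.
pose h : dual X := f + (of_real k t : K) *: g.
have hE z : h z = f z + of_real k t * g z by [].
have tg z : rnorm (of_real k t * g z : K^o) <= t * rnorm z.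
  by rewrite rnormM rnorm_of_real gtr0_norm// ler_pM2l.
pose N := opnorm h.
have N_le : N <= 1 + t.
  apply: opnorm_le => [|z]; first by rewrite addr_ge0// ltW.
  by rewrite hE (le_trans (rnormD _ _))// mulrDl mul1r lerD.
have hy : 1 - t <= rnorm (h y).
  have := rnormD (h y) (- (of_real k t * g y)); rewrite hE addrK fy rnorm1.
  rewrite rnormN; have := tg y; rewrite y1 mulr1 => ? ?; lra.
have N_ge : 1 + t * to_real (g x) <= N.
  have := rnorm_operator_le h x; rewrite x1 mulr1; apply: le_trans.
  rewrite (le_trans _ (to_real_le_rnorm _))// hE to_realD to_realZ fx.
  by rewrite -of_real1 of_realK.
have hyN : rnorm (h y) <= N.
  by have := rnorm_operator_le h y; rewrite y1 mulr1.
have N0 : 0 < N by lra.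
have NV : rnorm (of_real k N^-1 : K^o) = N^-1.
  by rewrite rnorm_of_real gtr0_norm ?invr_gt0.
(* The property requires norm one, so it is applied to [h] divided by its norm. *)
have [||y0 [y01 hy0 y0y]] := etaP ((of_real k N^-1 : K) *: h).
- by rewrite (opnorm_seminorm X K^o).2 NV mulVf// gt_eqF.
- rewrite -[X in rnorm X]/((of_real k N^-1 : K) *: h y) rnormZ NV.
  rewrite ltr_pdivlMl//; apply: lt_le_trans (hy).
  have : 2^-1 * eta <= N * eta by rewrite ler_pM2r//; lra.
  by move=> ?; lra.
have {}hy0 : rnorm (h y0) = N.
  move: hy0; rewrite -[X in rnorm X]/((of_real k N^-1 : K) *: h y0) rnormZ NV.
  by move=> /(congr1 ( *%R N)); rewrite mulrA mulfV ?mul1r ?mulr1// gt_eqF.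
have [c c1 chy0] := exists_phase (h y0).
rewrite hy0 in chy0.
have c_near1 : rnorm (c - 1) <= D / 8 + t + t.
  (* This follows from [c * h y0 = N] and [f y = 1]; the three terms are at most [D / 8], [t] and
     [t]. *)
  have -> : c - 1 = c * (f (y - y0) - of_real k t * g y0) + of_real k (N - 1).
    rewrite operatorB fy of_realD -chy0 hE of_realN of_real1.
    by ring.
  rewrite (le_trans (rnormD _ _))// lerD//; last first.
    by rewrite rnorm_of_real ler_norml; apply/andP; split; lra.
  rewrite rnormM c1 mul1r (le_trans (rnormD _ _))// rnormN lerD//.
    by rewrite (le_trans (f_le _))// rnormB ltW.
  by rewrite (le_trans (tg _))// y01 mulr1.
(* Compare [1 + t * to_real (g x) <= N] with the real part of [c * h y0 = N], where [c * f y0]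
   contributes at most 1, and cancel [t]. *)
have gx_le : to_real (g x) <= to_real (c * g y0).
  have := congr1 (@to_real R k) chy0; rewrite of_realK hE mulrDr mulrCA.
  rewrite to_realD to_realZ => NE.
  have cf : to_real (c * f y0) <= 1.
    rewrite (le_trans (to_real_le_rnorm _))// rnormM c1 mul1r.
    by rewrite (le_trans (f_le _))// y01.
  rewrite -(ler_pM2l t0); lra.
have : to_real (c * g y0) <= to_real (g y) + (D / 8 + (D / 8 + t + t)).
  have -> : c * g y0 = g y + (c * g (y0 - y) + (c - 1) * g y).
    by rewrite operatorB; ring.
  rewrite to_realD lerD2l (le_trans (to_real_le_rnorm _))//.
  rewrite (le_trans (rnormD _ _))// !rnormM c1 mul1r lerD//.
    by rewrite (le_trans (g_le _))// ltW.
  rewrite (le_trans _ c_near1)// ler_piMr ?rnorm_ge0//.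
  by rewrite (le_trans (g_le _))// y1.
(* The real parts of [g x] and [g y] would differ by at most [D / 2], yet they differ by [D > 0]. *)
by move=> ?; lra.
Qed.

End Proposition.

Theorem proposition2p1 (R : realType) (k : scalar_kind)
    (X : completeNormedModType (scalar_field R k)) :
  (reflexive_space X -> LUR X -> property_Lop X (scalar_field R k)^o) /\
  (Radon_Nikodym_property X -> property_Lop X (scalar_field R k)^o ->
   strictly_convex X).
Proof.
split; first exact: reflexive_LUR_property_Lop.
by move=> _; exact: property_Lop_strictly_convex.
Qed.
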